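(* Let $\mathbb{F}$ be an algebraically closed field of characteristic $0$, let $m,n\ge1$ be integers, let $\lambda,\mu\in\mathbb{F}$, and let $p(x,y)=\sum_{0\le i,j\le K}a_{ij}x^iy^j\in\mathbb{F}[x,y]$ be non-constant, with local degree $d\ge1$ at $(\lambda,\mu)$. Let $P(J_m(\lambda),J_n(\mu))=\sum_{0\le i,j\le K}a_{ij}\,(J_m(\lambda)^i\otimes J_n(\mu)^j)$. (i) If $d\ge m+n-1$, then there are precisely $mn$ Jordan blocks in the Jordan canonical form of $P(J_m(\lambda),J_n(\mu))$. (ii) If $d<m+n-1$, put $\delta=d-|n-m|$. Then the number of Jordan blocks in the Jordan canonical form of $P(J_m(\lambda),J_n(\mu))$ is bounded above by $\mathfrak{a}=\max(m,n)\min(m,n,d)$ and bounded below by $$\mathfrak{b}=\begin{cases} d\min(m,n) & \text{if }\delta\le0;\\ d\min(m,n)-\left\lfloor\frac{\delta^2}{4}\right\rfloor & \text{if }\delta>0.\end{cases}$$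
   Context: $\otimes$ is the Kronecker product. $J_m(\lambda)=\lambda I_m+N_m$ is the $m\times m$ Jordan block with eigenvalue $\lambda$ ($N_m$ has ones on the first superdiagonal and zeros elsewhere). Hasse derivatives: $\hat\partial_{x^\beta y^\gamma}p=\frac{1}{\beta!\,\gamma!}\frac{\partial^{\beta+\gamma}p}{\partial x^\beta\partial y^\gamma}$. The local degree of a non-constant $p\in\mathbb{F}[x,y]$ at $(\lambda,\mu)\in\mathbb{F}^2$ is the smallest integer $d\ge1$ such that there exist nonnegative integers $\beta,\gamma$ with $\beta+\gamma=d$ and $\hat\partial_{x^\beta y^\gamma}p(\lambda,\mu)\neq0$. *)

(* Defs.v *)
From HB Require Import structures.
From mathcomp Require Import all_boot all_order all_algebra.
From mathcomp.real_closed Require Export mxtens.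

Set Implicit Arguments.
Unset Strict Implicit.
Unset Printing Implicit Defensive.

Import Order.TTheory GRing.Theory Num.Theory.
Local Open Scope ring_scope.

Definition jordan_block (F : fieldType) (m : nat) (la : F) : 'M[F]_m :=
  la%:M + \matrix_(i < m, j < m) (i.+1 == j)%:R.

(* The diagonal blocks have sizes [r i] and eigenvalues [a i]; the [castmx]
   only identifies the total size of the blocks with the size of [A]. *)
Definition jordan_form_of (F : fieldType) (n : nat) (A : 'M[F]_n)
    (k : nat) (r : 'I_k -> nat) (a : 'I_k -> F) : Prop :=
  (forall i, (0 < r i)%N) /\
  exists e : (\sum_i r i)%N = n,
    A ~_{in unitmx} castmx (e, e) (\mxdiag_i jordan_block (r i) (a i)).

(* A relation, since a Jordan form is only unique up to the order of its
   blocks; [num_jordan_blocks_exists] below shows that it is total over an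
   algebraically closed field. *)
Definition num_jordan_blocks (F : fieldType) (n : nat) (A : 'M[F]_n)
    (k : nat) : Prop :=
  exists (r : 'I_k -> nat) (a : 'I_k -> F), jordan_form_of A r a.

(* [{poly {poly F}}] is read as in polyXY: the first variable x is the outer
   variable 'X, the second variable y is the inner variable 'Y = 'X%:P, and
   [p.[la%:P].[mu]] is the value of p at (la, mu). *)
Definition hasse_deriv (F : fieldType) (b c : nat) (p : {poly {poly F}}) :
    {poly {poly F}} :=
  ((b`! * c`!)%N%:R^-1)%:P *: map_poly (fun q : {poly F} => q^`(c)) p^`(b).

Definition is_local_degree (F : fieldType) (p : {poly {poly F}}) (la mu : F)
    (d : nat) : Prop :=
  let nonvanishing e := exists b c : nat,
    (b + c)%N = e /\ (hasse_deriv b c p).[la%:P].[mu] <> 0 in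
  [/\ (1 <= d)%N, nonvanishing d &
      forall e : nat, (1 <= e)%N -> nonvanishing e -> (d <= e)%N].

Section JordanFormExists.

Variable F : fieldType.
Local Notation chain n := {r : nat & ('M[F]_(r, n) * F)%type}.
Definition jordan_chain n (A : 'M[F]_n) (t : chain n) :=
  (0 < tag t)%N &&
  ((tagged t).1 *m A == jordan_block (tag t) (tagged t).2 *m (tagged t).1).

(* [s] is a list of Jordan chains for [A] whose rows together form a basis. *)
Definition jordan_basis n (A : 'M[F]_n) (s : seq (chain n)) :=
  [&& all (jordan_chain A) s,
      row_full (\sum_(t <- s) <<(tagged t).1>>)%MS
    & (\sum_(t <- s) tag t == n)%N].

Lemma jordan_basis_num n (A : 'M[F]_n) s :
  jordan_basis A s -> num_jordan_blocks A (size s).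
Proof.
case/and3P=> s0A s1 /eqP sn.
pose t i := tnth (in_tuple s) i.
have sA i : jordan_chain A (t i) by exact: (allP s0A) (mem_tnth i (in_tuple s)).
exists (fun i => tag (t i)), (fun i => (tagged (t i)).2).
split=> [i|]; first by have /andP[] := sA i.
have e : (\sum_i tag (t i))%N = n by apply: etrans sn; rewrite [RHS]big_tnth.
exists e.
pose M : 'M[F]_(\sum_i tag (t i), n) := \mxcol_i (tagged (t i)).1.
have MA : M *m A =
    (\mxdiag_i jordan_block (tag (t i)) (tagged (t i)).2) *m M.
  rewrite /M mxcol_mul mul_mxdiag_mxcol; apply/eq_mxcolP => i.
  by have /andP[_ /eqP] := sA i.
have Mfull : row_full M.
  rewrite -sub1mx; apply: submx_trans (_ : (_ <= \sum_(t <- s) <<(tagged t).1>>)%MS) _.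
    by rewrite sub1mx.
  rewrite [X in (X <= _)%MS]big_tnth; apply/sumsmx_subP => i _; rewrite genmxE.
  have -> : (tagged (t i)).1 = submxcol M i by rewrite mxcolK.
  exact: rowsub_sub.
clearbody M; move: (\mxdiag_i _) MA => D MA; clear sA s0A.
move: (\sum_i tag (t i))%N e M D MA Mfull => q e; subst q => M D MA Mfull.
rewrite castmx_id; exists M; first by rewrite -row_full_unit.
by apply/simmxP; rewrite -?row_full_unit.
Qed.

Lemma jordan_basis_cat n p q (A : 'M[F]_n) (A1 : 'M_p) (A2 : 'M_q)
    (U : 'M_(p, n)) (W : 'M_(q, n)) s1 s2 :
    (p + q)%N = n -> U *m A = A1 *m U -> W *m A = A2 *m W ->
    row_full (U + W)%MS -> jordan_basis A1 s1 -> jordan_basis A2 s2 ->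
  exists s, jordan_basis A s.
Proof.
move=> pqn UA WA UWf /and3P[s1A s1f /eqP s1n] /and3P[s2A s2f /eqP s2n].
pose f m (V : 'M[F]_(m, n)) (t : chain m) : chain n :=
  existT (fun r => ('M[F]_(r, n) * F)%type) (tag t)
         ((tagged t).1 *m V, (tagged t).2).
have fA m (V : 'M[F]_(m, n)) (B : 'M_m) t : V *m A = B *m V ->
  jordan_chain B t -> jordan_chain A (f m V t).
  move=> VA /andP[t_gt0 /eqP BJ]; rewrite /jordan_chain /= t_gt0 /=.
  by rewrite -mulmxA VA mulmxA BJ mulmxA.
have sumf m (V : 'M[F]_(m, n)) s : row_full (\sum_(t <- s) <<(tagged t).1>>)%MS ->
  (V <= \sum_(t <- [seq f m V t | t <- s]) <<(tagged t).1>>)%MS.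
  rewrite -sub1mx => s_full; rewrite -[X in (X <= _)%MS]mul1mx.
  apply: submx_trans (submxMr _ s_full) _ => {s_full}.
  rewrite big_map; elim: s => [|t s IHs].
    by rewrite !big_nil mul0mx sub0mx.
  rewrite !big_cons addsmxMr addsmxS //.
  by rewrite (eqmxMr V (genmxE _)) genmxE.
exists ([seq f p U t | t <- s1] ++ [seq f q W t | t <- s2]).
apply/and3P; split.
- rewrite all_cat !all_map; apply/andP; split.
    by apply: sub_all s1A => t; apply: fA.
  by apply: sub_all s2A => t; apply: fA.
- rewrite big_cat /= -sub1mx; apply: submx_trans (_ : (_ <= (U + W)%MS)%MS) _.
    by rewrite sub1mx.
  by rewrite addsmxS ?sumf.
- by rewrite big_cat !big_map /= s1n s2n pqn.
Qed.

Lemma jordan_basis_nilpotent n (a : F) (N : 'M[F]_n) k :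
  N ^+ k = 0 -> exists s, jordan_basis (a%:M + N) s.
Proof.
elim/ltn_ind: n => n IHn in N k *.
move=> Nk0; have [n0|n_gt0] := posnP n.
  by subst n; exists [::]; rewrite /jordan_basis /= !big_nil eqxx andbT
    -sub1mx thinmx0 sub0mx.
have ex0 : exists k, N ^+ k == 0 by exists k; apply/eqP.
case: (ex_minnP ex0) => {ex0}{}k /eqP{}Nk0 kmin.
case: k => [|k] in Nk0 kmin.
  move/matrixP/(_ (Ordinal n_gt0) (Ordinal n_gt0))/eqP: Nk0.
  by rewrite expr0 !mxE eqxx oner_eq0.
have Nz l : (k < l)%N -> N ^+ l = 0.
  by move=> kl; rewrite -(subnKC kl) exprD Nk0 mul0r.
have [i [j Nij]] : exists i j, (N ^+ k) i j != 0.
  have /eqP/matrix0Pn[i [j ?]] : N ^+ k <> 0.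
    by move/eqP/kmin; rewrite ltnn.
  by exists i, j.
pose U := \matrix_(l < k.+1, c < n) (N ^+ l) i c.
pose W := \matrix_(c < n, l < k.+1) (N ^+ (k - l)) c j.
have UN : U *m N = jordan_block k.+1 0 *m U.
  rewrite /jordan_block raddf0 add0r; apply/matrixP => l c.
  have -> : (U *m N) l c = (N ^+ l.+1) i c.
    by rewrite exprSr !mxE; apply: eq_bigr => e _; rewrite !mxE.
  rewrite mxE; have [lk|kl] := ltnP l k.
    rewrite (bigD1 (inord l.+1)) //= !mxE inordK // eqxx mul1r.
    rewrite big1 ?addr0 // => e; rewrite -val_eqE /= inordK // => le.
    by rewrite !mxE eq_sym (negPf le) mul0r.
  rewrite Nz // mxE big1 // => e _; rewrite !mxE.
  by rewrite gtn_eqF ?mul0r // ltnS (leq_trans _ kl) // -ltnS.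
have UA : U *m (a%:M + N) = jordan_block k.+1 a *m U.
  rewrite mulmxDr UN /jordan_block raddf0 add0r mulmxDl mul_mx_scalar.
  by rewrite mul_scalar_mx.
have UWu : U *m W \in unitmx.
  have UWE l l' : (U *m W) l l' = (N ^+ (l + (k - l'))) i j.
    by rewrite exprD !mxE; apply: eq_bigr => e _; rewrite !mxE.
  rewrite -unitmx_tr unitmxE det_trig; last first.
    apply/is_trig_mxP => l l' ll'; rewrite mxE UWE Nz ?mxE //.
    have := ltn_ord l; rewrite ltnS => lk.
    by rewrite addnBA // ltn_subRL ltn_add2r.
  apply: rpred_prod => l _; rewrite mxE UWE subnKC -1?ltnS //.
  by rewrite unitfE.
have WN x : (x : 'rV_n) *m W = 0 -> x *m N *m W = 0.
  move=> xW; apply/matrixP => i0 l; rewrite -mulmxA.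
  have colM (Y : 'M_(n, k.+1)) y : col l ((y : 'rV_n) *m Y) = y *m col l Y.
    by rewrite !colE mulmxA.
  have [l0|l_gt0] := posnP l.
    have Wl : col l (N *m W) = 0.
      apply/matrixP => c l1; rewrite !mxE.
      have := Nk0; rewrite exprS => /matrixP/(_ c j); rewrite !mxE => {2}<-.
      by apply: eq_bigr => e _; rewrite !mxE l0 subn0.
    have /matrixP/(_ i0 ord0) : col l (x *m (N *m W)) = 0.
      by rewrite colM Wl mulmx0.
    by rewrite !mxE.
  have lk : (l.-1 < k.+1)%N by rewrite (leq_ltn_trans (leq_pred _)).
  have Wl : col l (N *m W) = col (Ordinal lk) W.
    apply/matrixP => c l1; rewrite !mxE.
    have -> : (k - l.-1 = (k - l).+1)%N.
      by rewrite -subSn -1?ltnS // -[in RHS](prednK l_gt0) subSS.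
    by rewrite exprS mxE; apply: eq_bigr => e _; rewrite !mxE.
  have /matrixP/(_ i0 ord0) : col l (x *m (N *m W)) = 0.
    by rewrite colM Wl colE mulmxA xW mul0mx.
  by rewrite !mxE.
pose K := row_base (kermx W).
have [/eqP rU /eqP rW] : \rank U == k.+1 /\ \rank W == k.+1.
  have /eqP rUW : \rank (U *m W) == k.+1 by rewrite -[_ == _]/(row_free _) row_free_unit.
  rewrite !eqn_leq rank_leq_row rank_leq_col.
  split; first by have := mxrankM_maxl U W; rewrite rUW.
  by have := mxrankM_maxr U W; rewrite rUW.
have kn : (k < n)%N by rewrite -rU rank_leq_col.
have rK : \rank (kermx W) = (n - k.+1)%N by rewrite mxrank_ker rW.
have stK : stablemx (kermx W) N.
  apply/row_subP => l; rewrite row_mul; apply/sub_kermxP/WN.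
  by rewrite -row_mul mulmx_ker row0.
have /submxP[B KN] : (K *m N <= K)%MS.
  by rewrite stablemx_row_base.
have full : row_full (U + K)%MS.
  rewrite /row_full; have := mxrank_sum_cap U K.
  have -> : (U :&: K)%MS = 0.
    apply/eqP/rowV0P => x; rewrite sub_capmx eq_row_base => /andP[/submxP[y ->]].
    move/sub_kermxP; rewrite -mulmxA => /(canRL (mulmxK UWu)).
    by rewrite mul0mx => ->; rewrite mul0mx.
  by rewrite mxrank0 addn0 => ->; rewrite eq_row_base rU rK subnKC.
have KB l : K *m N ^+ l = B ^+ l *m K.
  elim: l => [|l IHl]; first by rewrite !expr0 mulmx1 mul1mx.
  by rewrite !exprSr -mulmxE mulmxA IHl -mulmxA KN mulmxA.
have Bk0 : B ^+ k.+1 = 0.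
  apply: (row_free_inj (row_base_free (kermx W))).
  by rewrite -KB Nk0 mulmx0 mul0mx.
have rKn : (\rank (kermx W) < n)%N by rewrite rK ltn_subrL n_gt0.
have [s2 s2P] := IHn _ rKn B _ Bk0.
have s1P : jordan_basis (jordan_block k.+1 a)
    [:: existT (fun r => ('M[F]_(r, k.+1) * F)%type) k.+1 (1%:M, a)].
  apply/and3P; split; rewrite ?big_seq1 //=.
    by rewrite /jordan_chain /= mul1mx mulmx1 eqxx.
  by rewrite -sub1mx genmxE.
apply: jordan_basis_cat UA _ full s1P s2P; first by rewrite rK subnKC.
by rewrite mulmxDr mulmxDl KN mul_mx_scalar mul_scalar_mx.
Qed.

End JordanFormExists.

Theorem num_jordan_blocks_exists (F : closedFieldType) (n : nat)
  (A : 'M[F]_n) : exists k, num_jordan_blocks A k.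
Proof.
suff [s /jordan_basis_num sA] : exists s, jordan_basis A s by exists (size s).
elim/ltn_ind: n => n IHn in A *.
case: n => [|n] in IHn A *.
  by exists [::]; rewrite /jordan_basis /= !big_nil eqxx andbT
    -sub1mx thinmx0 sub0mx.
have [a ra] : exists a, root (char_poly A) a.
  by apply/closed_rootP; rewrite size_char_poly.
have [m [q /implyP]] := multiplicity_XsubC (char_poly A) a.
rewrite monic_neq0 ?char_poly_monic // => /(_ isT) nqa Ap.
have m_gt0 : (0 < m)%N.
  by case: m Ap ra => // ->; rewrite expr0 mulr1 (negPf nqa).
have cop : coprimep (('X - a%:P) ^+ m) q.
  by rewrite coprimep_expl // coprimep_sym coprimep_XsubC.
pose U := kermxpoly A (('X - a%:P) ^+ m); pose V := kermxpoly A q.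
have UV1 : (U + V :=: 1%:M)%MS.
  apply: eqmx_trans (eqmx_sym (kermxpolyM A cop)) _.
  by rewrite mulrC -Ap; apply/kermxpoly_min/mxminpoly_dvd_char.
have UV0 : (U :&: V = 0)%MS by apply: mxdirect_kermxpoly.
have rUV : (\rank U + \rank V = n.+1)%N.
  by rewrite -mxrank_sum_cap UV0 mxrank0 addn0 UV1 mxrank1.
have [Ufull|Un] := eqVneq (\rank U) n.+1.
  have N0 : (A - a%:M) ^+ m = 0.
    have : row_full U by rewrite /row_full Ufull.
    rewrite -sub1mx => /sub_kermxP; rewrite mul1mx => <-.
    by rewrite rmorphXn rmorphB /= horner_mx_X horner_mx_C.
  have [s] := jordan_basis_nilpotent a N0.
  by rewrite addrC subrK; exists s.
have U_gt0 : (0 < \rank U)%N.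
  have: (0 < \rank (eigenspace A a))%N.
    by rewrite lt0n mxrank_eq0 -[_ != 0]/(eigenvalue A a) eigenvalue_root_char.
  move=> /leq_trans-> //; apply: mxrankS.
  rewrite eigenspace_poly; apply/sub_kermxP.
  rewrite -(prednK m_gt0) exprS rmorphM /= -mulmxE mulmxA.
  by rewrite /kermxpoly mulmx_ker mul0mx.
have stable W : stablemx W A ->
    exists B : 'M_(\rank W), row_base W *m A = B *m row_base W.
  by rewrite -stablemx_row_base => /submxP.
have /stable[B1 UB] : stablemx U A by apply: comm_mx_stable_kermxpoly.
have /stable[B2 VB] : stablemx V A by apply: comm_mx_stable_kermxpoly.
have rU : (\rank U < n.+1)%N by rewrite ltn_neqAle Un rank_leq_row.
have rV : (\rank V < n.+1)%N by have := ltn_add2r (\rank V) 0 (\rank U); rewrite rUV => ->.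
have [s1 s1P] := IHn _ rU B1.
have [s2 s2P] := IHn _ rV B2.
apply: jordan_basis_cat rUV UB VB _ s1P s2P.
by rewrite -sub1mx -UV1 addsmxS ?eq_row_base.
Qed.

(* Main.v *)
Require Import Defs.
From mathcomp Require Import all_boot all_order all_algebra.
From mathcomp Require Import zify ring.

Set Implicit Arguments.
Unset Strict Implicit.
Unset Printing Implicit Defensive.

Import Order.TTheory GRing.Theory Num.Theory.
Local Open Scope ring_scope.

(** Expanding p at (la, mu) turns P into the matrix of the multiplication by
    t(x, y) = p(la + x, mu + y) on the algebra F[x, y] / (x^m, y^n), in its
    basis of monomials x^i y^j: Hasse derivatives are Taylor coefficients, and
    the powers of a Jordan block are given by the binomial formula
    ([jordan_block_exprE], [kron_eval_entry]). The constant term c = t(0, 0) is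
    the only eigenvalue, because q = t - c has no constant term and so acts
    nilpotently; each Jordan block then contributes 1 to the nullity of P - c,
    and the number of blocks is mn - rank(q)
    ([num_jordan_blocks_single_eigenvalue]). Only the rank of the
    multiplication by q remains to be estimated, knowing that q starts in
    degree d exactly.

    If d >= m + n - 1, then q = 0 in the algebra, whose top degree is m + n - 2.

    Lower bound on the nullity: q maps monomials of degree at least k to
    combinations of monomials of degree at least k + d. So its matrix vanishes
    outside the rows of degree < k and the columns of degree >= k + d, and the
    nullity is at least the number of monomials of degree in [k, k + d)
    ([nullity_ge_window]). The numbers of monomials in the successive degrees
    form a trapezium whose plateau has height min(m, n) and length
    |n - m| + 1. A window of length d fits under the plateau if delta <= 0, and
    counts d * min(m, n) monomials; if delta > 0, it overhangs by delta - 1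
    degrees, and sharing them evenly between the two slopes loses
    floor(delta^2 / 4) monomials ([antidiagonal_window]).

    Upper bound on the nullity, when d < min(m, n): let x^b y^(d-b) be the
    monomial of lowest degree in q with least exponent of x. The products of q
    with the monomials x^i y^j, i < m - b, j < n - (d - b), have pairwise
    distinct lowest monomials, none of which vanishes in the algebra, so they
    are independent ([rank_kron_eval_sub_ge]). The resulting bound
    (m - b)(n - d + b) on the rank is concave in b, hence smallest at b = 0 or
    b = d, where it is at least mn - d * max(m, n). *)

(** * Bounds on the rank of a matrix with many zeros *)

(** The easy half of a Koenig-type principle: the rank is at most the number of
    lines needed to cover the nonzero entries. *)
Lemma rank_le_cover (F : fieldType) (p q : nat) (A : 'M[F]_(p, q))
    (R : {set 'I_p}) (C : {set 'I_q}) :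
  (forall i j, i \notin R -> j \notin C -> A i j = 0) ->
  (\rank A <= #|R| + #|C|)%N.
Proof.
move=> A0.
(* Columns reduce to rows by splitting [A] and transposing the second part. *)
have rank_le_rows p' q' (B : 'M[F]_(p', q')) (S : {set 'I_p'}) :
    (forall i j, i \notin S -> B i j = 0) -> (\rank B <= #|S|)%N.
  move=> B0; have -> : B = \sum_(i in S) delta_mx i i *m B.
    apply/matrixP => i j; rewrite summxE.
    have E k : (delta_mx k k *m B) i j = (i == k)%:R * B k j.
      rewrite mxE (bigD1 k) //= big1 ?addr0 => [|l lk].
        by rewrite mxE eqxx andbT.
      by rewrite mxE (negPf lk) andbF mul0r.
    rewrite (eq_bigr _ (fun k _ => E k)).
    have [iS|iS] := boolP (i \in S).
      rewrite (bigD1 i) //= eqxx mul1r big1 ?addr0 // => k /andP[_ ki].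
      by rewrite eq_sym (negPf ki) mul0r.
    rewrite B0 // big1 // => k kS.
    by case: eqP iS => [->|_ _]; rewrite ?kS ?mul0r.
  rewrite -sum1_card; elim/big_rec2: _ => [|i s M _ le_Ms].
    by rewrite mxrank0.
  rewrite (leq_trans (mxrank_add _ _)) // leq_add //.
  by rewrite (leq_trans (mxrankM_maxl _ _)) // mxrank_delta.
pose A1 := \matrix_(i, j) (if i \in R then A i j else 0).
pose A2 := \matrix_(i, j) (if i \in R then 0 else A i j).
have -> : A = A1 + A2.
  by apply/matrixP => i j; rewrite !mxE; case: ifP; rewrite ?addr0 ?add0r.
rewrite (leq_trans (mxrank_add _ _)) // leq_add //.
  by apply: rank_le_rows => i j iR; rewrite mxE (negPf iR).
rewrite -mxrank_tr; apply: rank_le_rows => i j iC.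
by rewrite !mxE; case: ifPn => // jR; apply: A0.
Qed.

(** For any order on [I] that refines the weight [w], the submatrix of rows [f]
    and columns [g] is triangular with nonzero diagonal, hence invertible; the
    weight dispenses with sorting [I]. *)
Lemma rank_ge_triangular (F : fieldType) (p q : nat) (A : 'M[F]_(p, q))
    (I : finType) (f : I -> 'I_p) (g : I -> 'I_q) (w : I -> nat) :
  (forall s, A (f s) (g s) != 0) ->
  (forall s t, t != s -> (w s <= w t)%N -> A (f t) (g s) = 0) ->
  (#|I| <= \rank A)%N.
Proof.
move=> Adiag Alow.
pose B := mxsub (f \o enum_val) (g \o enum_val) A : 'M_#|I|.
have: row_free B.
  rewrite -kermx_eq0; apply/rowV0P => v /sub_kermxP vB0.
  apply/eqP; apply: contraT => /matrix0Pn[i0 [s0 vs0]].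
  (* A relation between the rows is impossible: at an index of least weight in
     its support, the corresponding column sees only the diagonal entry. *)
  case: (@arg_minnP _ s0 (fun s => v i0 s != 0) (fun s => w (enum_val s)) vs0).
  move=> s vs smin; move/matrixP/(_ i0 s)/eqP: vB0.
  rewrite !mxE (bigD1 s) //= big1 => [|t ts].
    by rewrite addr0 mulf_eq0 (negPf vs) mxE (negPf (Adiag _)).
  have [->|vt] := eqVneq (v i0 t) 0; first by rewrite mul0r.
  rewrite mxE Alow ?mulr0 ?smin //.
  by apply: contraNneq ts => /enum_val_inj->.
rewrite /row_free => /eqP <-; rewrite /B mxsubrc.
rewrite (leq_trans (mxrankS (rowsub_sub _ _))) //.
by rewrite -mxrank_tr trmx_mxsub -(mxrank_tr A) mxrankS // rowsub_sub.
Qed.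

Lemma card_set_sum (T : finType) (Q : pred T) :
  #|[set x | Q x]| = (\sum_x Q x)%N.
Proof.
by rewrite -sum1dep_card big_mkcond; apply: eq_bigr => x _; case: (Q x).
Qed.

(** * Matrices that raise a degree *)

Section Raising.
Variables (F : fieldType) (N : nat) (A : 'M[F]_N) (deg : 'I_N -> nat) (d : nat).
Hypothesis A_raise : forall u v, (deg v < deg u + d)%N -> A u v = 0.

(** The nonzero entries are covered by the rows of degree < [k] and the columns
    of degree >= [k + d]; the indices that are left out on both sides form the
    window. *)
Lemma nullity_ge_window (k : nat) :
  (#|[set u | k <= deg u < k + d]| <= N - \rank A)%N.
Proof.
set W := [set u | _].
set L := [set u | (deg u < k)%N]; set H := [set u | (k + d <= deg u)%N].
have rkA : (\rank A <= #|L| + #|H|)%N.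
  apply: rank_le_cover => u v; rewrite !inE -leqNgt -ltnNge => ku vd.
  by apply: A_raise; rewrite (leq_trans vd) // leq_add2r.
have cardW : (#|L| + #|H| + #|W| = N)%N.
  rewrite !card_set_sum -!big_split /= -[RHS]card_ord -sum1_card.
  by apply: eq_bigr => u _; lia.
lia.
Qed.

Lemma raising_expr_entry e u v :
  (deg v < deg u + e * d)%N -> (A ^+ e) u v = 0.
Proof.
elim: e u v => [|e IHe] u v.
  rewrite mul0n addn0 expr0 mxE => vu.
  by case: eqP vu => // ->; rewrite ltnn.
move=> vu; rewrite exprS mxE big1 // => s _.
have [su|us] := ltnP (deg s) (deg u + d); first by rewrite A_raise ?mul0r.
rewrite IHe ?mulr0 //; rewrite (leq_trans vu) //.
by rewrite mulSn addnA leq_add2r.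
Qed.

Lemma raising_nilpotent : (0 < d)%N -> exists e, A ^+ e = 0.
Proof.
move=> d_gt0; exists (\max_u deg u).+1; apply/matrixP => u v.
rewrite mxE raising_expr_entry //.
have := leq_bigmax v : (deg v <= \max_u deg u)%N.
by nia.
Qed.

End Raising.

(** * Jordan blocks *)

Lemma jordan_block_exprE (F : fieldType) (m : nat) (la : F) (k : nat)
    (u v : 'I_m) :
  (jordan_block m la ^+ k) u v =
  if (u <= v)%N then la ^+ (k - (v - u)) *+ 'C(k, v - u) else 0.
Proof.
elim: k u v => [|k IHk] u v.
  rewrite expr0 mxE bin0n sub0n expr0 subn_eq0.
  by rewrite -val_eqE /= eqn_leq; case: leqP => //= _; case: leqP.
have E : (jordan_block m la ^+ k.+1) u v =
   la * (jordan_block m la ^+ k) u v +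
   (if (u < v)%N then la ^+ (k - (v.-1 - u)) *+ 'C(k, v.-1 - u) else 0).
  rewrite exprSr {2}/jordan_block -mulmxE mulmxDr mxE mul_mx_scalar [_ u v]mxE.
  congr (_ + _); rewrite mxE.
  have [v0|v_gt0] := posnP v.
    by rewrite v0 /= big1 // => s _; rewrite mxE v0 mulr0.
  have lt_v : (v.-1 < m)%N by rewrite (leq_ltn_trans (leq_pred _)).
  rewrite (bigD1 (Ordinal lt_v)) //= big1 ?addr0 => [|s sv].
    by rewrite mxE /= prednK // eqxx mulr1 IHk /= -ltnS prednK.
  rewrite mxE; case: eqP => [sv1|]; last by rewrite mulr0.
  by case/eqP: sv; apply: val_inj; rewrite /= -sv1.
rewrite {}E IHk; case: (ltngtP u v) => uv.
- have -> : (v - u = (v.-1 - u).+1)%N by lia.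
  rewrite binS subSS mulrnDr; congr (_ + _).
  have [ks|ks] := ltnP (v.-1 - u) k; last by rewrite bin_small // !mulr0n mulr0.
  by rewrite mulrnAr -exprS; congr (la ^+ _ *+ _); lia.
- by rewrite mulr0 addr0.
- by rewrite uv subnn !bin0 !subn0 addr0 exprS !mulr1n.
Qed.

Lemma rank_jordan_block_sub (F : fieldType) (m : nat) (la : F) :
  \rank (jordan_block m la - la%:M) = m.-1.
Proof.
rewrite /jordan_block addrC addKr; case: m => [|m].
  by rewrite thinmx0 mxrank0.
apply/eqP; rewrite eqn_leq /=; apply/andP; split.
  apply: leq_trans (@rank_le_cover _ _ _ _ [set~ ord_max] set0 _) _.
    move=> i j; rewrite !inE negbK => /eqP-> _; rewrite mxE.
    by rewrite gtn_eqF.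
  by rewrite cards0 addn0 cardsC1 card_ord.
rewrite -{1}[m]card_ord.
apply: (@rank_ge_triangular _ _ _ _ _ (widen_ord (leqnSn m)) (lift ord0)
          (fun s => m - s)%N) => [s|s t ts _]; rewrite mxE /= /bump /=.
  by rewrite eqxx oner_eq0.
by rewrite eqSS (negPf ts : (t == s :> nat) = false).
Qed.

(** A block of size [r i] contributes [(r i).-1] to the rank of [A - c%:M] once
    its eigenvalue is known to be [c], and this holds because the last vector of
    its chain is an eigenvector of a nilpotent matrix. *)
Lemma num_jordan_blocks_single_eigenvalue (F : fieldType) (N : nat)
    (A : 'M[F]_N) (c : F) (e k : nat) :
  (A - c%:M) ^+ e = 0 -> num_jordan_blocks A k ->
  k = (N - \rank (A - c%:M)%R)%N.
Proof.
move=> Ae [r [a [r_gt0 [eN]]]]; case: N / eN A Ae => A Ae [V Vu].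
rewrite castmx_id; have Vfree : row_free V by rewrite row_free_unit.
move/(simmxP Vu) => VA.
have ac i : a i = c.
  pose W := submxcol V i.
  have WA : W *m A = jordan_block (r i) (a i) *m W.
    move: VA; rewrite -[V]submxcolK mxcol_mul mul_mxdiag_mxcol.
    by move/eq_mxcolP/(_ i).
  have lt_r : ((r i).-1 < r i)%N by rewrite prednK.
  pose w := row (Ordinal lt_r) W.
  have wA : w *m (A - c%:M) = (a i - c) *: w.
    rewrite mulmxBr mul_mx_scalar scalerBl; congr (_ - _).
    rewrite -row_mul WA mulmxDl mul_scalar_mx linearD linearZ /= -[RHS]addr0.
    congr (_ + _); apply/matrixP => i0 j; rewrite !mxE big1 // => l _.
    by rewrite mxE /= prednK // gtn_eqF ?mul0r.
  have w_neq0 : w != 0.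
    rewrite /w /W /submxcol row_rowsub rowE; set l := tagnat.Rank _ _.
    apply/eqP => lV0.
    have /(row_free_inj Vfree)/matrixP/(_ 0 l)/eqP :=
      etrans lV0 (esym (mul0mx _ V)).
    by rewrite !mxE !eqxx oner_eq0.
  have wAe l : w *m (A - c%:M) ^+ l = (a i - c) ^+ l *: w.
    elim: l => [|l IHl]; first by rewrite !expr0 mulmx1 scale1r.
    by rewrite !exprS -mulmxE mulmxA wA -scalemxAl IHl scalerA.
  move/eqP: (wAe e); rewrite Ae mulmx0 eq_sym scaler_eq0 (negPf w_neq0) orbF.
  by rewrite expf_eq0 subr_eq0 => /andP[_ /eqP].
have -> : \rank (A - c%:M) = (\sum_i (r i).-1)%N.
  have VAc : V *m (A - c%:M) =
      (\mxdiag_i (jordan_block (r i) c - c%:M)) *m V.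
    rewrite mxdiagB mxdiagZ mulmxBr mulmxBl VA mul_mx_scalar mul_scalar_mx.
    by have -> : \mxdiag_i jordan_block (r i) (a i) =
      \mxdiag_i jordan_block (r i) c by apply: eq_mxdiag => i; rewrite ac.
  have -> : \rank (A - c%:M) = \rank (V *m (A - c%:M)).
    rewrite -[RHS]mxrank_tr trmx_mul mxrankMfree ?mxrank_tr //.
    by rewrite row_free_unit unitmx_tr.
  rewrite VAc mxrankMfree // rank_mxdiag.
  by apply: eq_bigr => i _; apply: rank_jordan_block_sub.
have -> : (\sum_i r i = \sum_i (r i).-1 + \sum_(i < k) 1)%N.
  by rewrite -big_split; apply: eq_bigr => i _; rewrite /= addn1 prednK.
by rewrite sum1_card card_ord addKn.
Qed.

(** * Counting monomials in a window of degrees *)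

Lemma sum_interval (n i k d : nat) :
  (\sum_(j < n) (k <= i + j < k + d) = minn n (k + d - i) - (k - i))%N.
Proof.
elim: n => [|n IHn]; first by rewrite big_ord0 min0n sub0n.
by rewrite big_ord_recr /= IHn; lia.
Qed.

Lemma sum_staircase (b m : nat) : ((\sum_(i < m) (b - i)) * 2 <= b * b.+1)%N.
Proof.
elim: m b => [|m IHm] [|b]; rewrite ?big_ord0 //.
  by rewrite big1.
rewrite big_ord_recl /= subn0; under eq_bigr do rewrite /bump /= add1n subSS.
by move: (IHm b); move: (\sum_(i < m) _)%N => S; nia.
Qed.

(** The rectangle {0..m-1} x {0..n-1} has antidiagonals of length at most [m],
    and exactly [m] on n - m + 1 of them. Placing the window so that it exceeds
    this plateau by [a] antidiagonals below and by [b] above, with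
    |a - b| <= 1, loses 1 + ... + a and 1 + ... + b points. *)
Lemma antidiagonal_window (m n d : nat) :
  (0 < m <= n)%N -> (d < m + n - 1)%N ->
  exists k : nat, (d * m <=
    \sum_(i < m) \sum_(j < n) (k <= i + j < k + d) + (d - (n - m)) ^ 2 %/ 4)%N.
Proof.
move=> /andP[m_gt0 le_mn] lt_d; set D := (d - (n - m))%N.
have [a [b half]] : exists a b,
    (D = 0 /\ a = 0 /\ b = 0 \/ D = a + b + 1 /\ (b = a \/ b = a.+1))%N.
  case: (D) => [|D']; first by exists 0, 0; left.
  exists D'./2, (uphalf D'); right; rewrite uphalf_half.
  by have := odd_double_half D'; case: (odd D'); lia.
exists (m.-1 - a)%N; set k := (m.-1 - a)%N.
have le_d : (d <= a + b + 1 + (n - m))%N by rewrite /D in half; lia.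
have le_a : (a <= m.-1)%N by rewrite /D in half; lia.
(* Row [i] meets the window in [d] points, except those cut off by the right
   edge, at most [b - i], or by the left edge, [i - k] of them. *)
have row (i : 'I_m) :
    (d <= \sum_(j < n) (k <= i + j < k + d) + (b - i) + (a - rev_ord i))%N.
  rewrite sum_interval /=; have := ltn_ord i.
  move: (nat_of_ord i) => {}i lt_im.
  have -> : (a - (m - i.+1) = i - k)%N by rewrite /k; lia.
  have le_end : (k + d <= n + b)%N by rewrite /k; lia.
  clearbody k; clear -le_end; lia.
have -> : (d * m = \sum_(i < m) d)%N by rewrite sum_nat_const card_ord mulnC.
rewrite (leq_trans (leq_sum _ (fun i _ => row i))) // !big_split /=.
have -> : (\sum_(i < m) (a - rev_ord i) = \sum_(i < m) (a - i))%N.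
  by rewrite [RHS](reindex_inj rev_ord_inj).
rewrite -addnA leq_add2l leq_divRL //.
have := sum_staircase b m; have := sum_staircase a m.
set S := (\sum_(i < m) (a - i))%N; set T := (\sum_(i < m) (b - i))%N.
clearbody S T; case: half => [[-> [-> ->]]|[->]]; first by lia.
by case=> ->; lia.
Qed.

Lemma antidiagonal_window_sym (m n d : nat) :
  (0 < m)%N -> (0 < n)%N -> (d < m + n - 1)%N ->
  exists k : nat, (d * minn m n <=
    \sum_(i < m) \sum_(j < n) (k <= i + j < k + d)
      + (d - (maxn m n - minn m n)) ^ 2 %/ 4)%N.
Proof.
move=> m_gt0 n_gt0 lt_d.
have [le_mn|/ltnW le_nm] := leqP m n.
  by apply: antidiagonal_window => //; rewrite m_gt0.
have [||k] := @antidiagonal_window n m d;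
  rewrite ?n_gt0 // 1?[(n + m)%N]addnC //.
move=> le_k; exists k; rewrite exchange_big /= (leq_trans le_k) // leq_add2r.
by apply: leq_sum => i _; apply: leq_sum => j _; rewrite addnC.
Qed.

(** * Polynomials in two commuting Jordan blocks *)

Section Kronecker.
Variables (F : fieldType) (m n : nat) (la mu : F) (K : nat).
Variable (a : 'I_K -> 'I_K -> F).

(** The coefficient of x^b y^c in p(la + x, mu + y), by the binomial formula. *)
Definition taylor_coef (b c : nat) : F :=
  \sum_(i < K) \sum_(j < K) a i j *
     ((la ^+ (i - b) *+ 'C(i, b)) * (mu ^+ (j - c) *+ 'C(j, c))).

(** Both sides are linear in p; on x^i y^j, the factor 1 / (b! c!) turns the
    falling factorials of the derivatives into binomial coefficients. *)
Lemma hasse_deriv_eval (charF0 : [pchar F] =i pred0) (b c : nat) :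
  (hasse_deriv b c (\sum_(i < K) \sum_(j < K)
     (a i j)%:P *: ('X^i * ('X^j)%:P))).[la%:P].[mu] = taylor_coef b c.
Proof.
pose ev p := (hasse_deriv b c p : {poly {poly F}}).[la%:P].[mu].
pose D := fun q : {poly F} => q^`(c).
have D0 : D 0 = 0 by rewrite /D linear0.
have evD : {morph ev : p q / p + q}.
  move=> p q; rewrite /ev /hasse_deriv -hornerD -hornerD -scalerDr.
  congr (_ *: _).[_].[_].
  apply/polyP => i; rewrite linearD /=.
  by rewrite coefD !(coef_map_id0 _ _ D0) coefD /D linearD.
have ev0 : ev 0 = 0.
  by rewrite /ev /hasse_deriv linear0 map_poly0 scaler0 !horner0.
rewrite /taylor_coef -/(ev _) (big_morph ev evD ev0); apply: eq_bigr => i _.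
rewrite (big_morph ev evD ev0); apply: eq_bigr => j _ {evD ev0}.
have fact_neq0 (l : nat) : l`!%:R != 0 :> F.
  by move/pcharf0P: charF0 => ->; rewrite -lt0n fact_gt0.
rewrite /ev /hasse_deriv.
have -> : (a i j)%:P *: ('X^i * ('X^j)%:P) =
    (a i j *: 'X^j) *: 'X^i :> {poly {poly F}}.
  by rewrite mulrC mul_polyC scalerA mul_polyC.
rewrite linearZ /= derivnXn.
have -> : map_poly (fun q : {poly F} => q^`(c))
      ((a i j *: 'X^j) *: ('X^(i - b) *+ i ^_ b)) =
    (a i j *: ('X^(j - c) *+ j ^_ c)) *: ('X^(i - b) *+ i ^_ b).
  rewrite -(derivnXn _ j c); apply/polyP => l.
  rewrite (coef_map_id0 _ _ D0) !coefZ coefMn coefXn.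
  case: eqP => _; last by rewrite mul0rn !mulr0 /= D0.
  by rewrite !mulr_natr /D linearMn linearZ.
rewrite !hornerZ !hornerMn !hornerXn hornerM hornerC hornerM hornerZ.
rewrite !hornerMn hornerXn horner_exp hornerC natrM invfM -!bin_ffact.
field.
by rewrite !fact_neq0.
Qed.

Definition kron_eval : 'M[F]_(m * n) :=
  \sum_(i < K) \sum_(j < K)
    a i j *: (jordan_block m la ^+ i *t jordan_block n mu ^+ j).

(** The total degree i + j of the monomial x^i y^j of which [u] is the index. *)
Definition box_deg (u : 'I_(m * n)) : nat :=
  ((mxtens_unindex u).1 + (mxtens_unindex u).2)%N.

Lemma card_box_deg (k d : nat) :
  #|[set u | (k <= box_deg u < k + d)%N]| =
  (\sum_(i < m) \sum_(j < n) (k <= i + j < k + d))%N.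
Proof.
rewrite card_set_sum pair_big /= (reindex (@mxtens_index m n)) /=.
  by apply: eq_bigr => u _; rewrite /box_deg mxtens_indexK.
exists (@mxtens_unindex m n) => u _; first exact: mxtens_indexK.
exact: mxtens_unindexK.
Qed.

(** Row x^i y^j of the multiplication by p(la + x, mu + y) on
    F[x, y] / (x^m, y^n). *)
Lemma kron_eval_entry (i i' : 'I_m) (j j' : 'I_n) :
  kron_eval (mxtens_index (i, j)) (mxtens_index (i', j')) =
  if (i <= i')%N && (j <= j')%N then taylor_coef (i' - i) (j' - j) else 0.
Proof.
rewrite /kron_eval summxE; under eq_bigr do rewrite summxE.
under eq_bigr do under eq_bigr do rewrite mxE tensmxE !jordan_block_exprE.
case: leqP => _ /=; last first.
  by rewrite big1 // => l _; rewrite big1 // => l' _; rewrite mul0r mulr0.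
case: leqP => _ //.
by rewrite big1 // => l _; rewrite big1 // => l' _; rewrite !mulr0.
Qed.

(* The multiplication by q, the polynomial without its constant term. *)
Let Q : 'M[F]_(m * n) := kron_eval - (taylor_coef 0 0)%:M.

Lemma kron_eval_sub_entry (i i' : 'I_m) (j j' : 'I_n) :
  Q (mxtens_index (i, j)) (mxtens_index (i', j')) =
  if [&& i <= i', j <= j' & i + j < i' + j']%N
  then taylor_coef (i' - i) (j' - j) else 0.
Proof.
rewrite /Q mxE kron_eval_entry mxE mxE (can_eq (@mxtens_indexK m n)) xpair_eqE.
rewrite -!val_eqE /=.
case: (leqP i i') => ii; case: (leqP j j') => jj /=; first last.
- by rewrite gtn_eqF //= subr0.
- by rewrite gtn_eqF //= subr0.
- by rewrite [j == j' :> nat]gtn_eqF // andbF subr0.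
case: ltnP => [lt_deg|le_deg].
  case: eqP => [ei|_] /=; last by rewrite subr0.
  case: eqP => [ej|_] /=; rewrite ?subr0 //.
  by move: lt_deg; rewrite ei ej ltnn.
have -> : (i = i' :> nat) by lia.
have -> : (j = j' :> nat) by lia.
by rewrite !eqxx !subnn subrr.
Qed.

Variable d : nat.
Hypothesis low0 : forall b c, (0 < b + c < d)%N -> taylor_coef b c = 0.

Lemma kron_eval_sub_raise u v : (box_deg v < box_deg u + d)%N -> Q u v = 0.
Proof.
case: (mxtens_indexP u) => i j; case: (mxtens_indexP v) => i' j'.
rewrite /box_deg !mxtens_indexK kron_eval_sub_entry /= => lt_deg.
by case: ifP => // /and3P[ii jj ij]; apply: low0; lia.
Qed.

(** x^b y^(d-b) is the lowest monomial of q for the order that compares total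
    degrees first and exponents of x next. Its translates inside the rectangle
    are the lowest monomials of the multiples of q, which gives a triangular
    minor. *)
Lemma rank_kron_eval_sub_ge b :
  (0 < d)%N -> (b <= d)%N -> taylor_coef b (d - b) != 0 ->
  (forall b', (b' < b)%N -> taylor_coef b' (d - b') = 0) ->
  ((m - b) * (n - (d - b)) <= \rank Q)%N.
Proof.
move=> d_gt0 le_bd tb minb; set c := (d - b)%N.
have bcd : (b + c)%N = d by rewrite subnKC.
have lt_row p q (i : 'I_(p - q)) : (i < p)%N by have := ltn_ord i; lia.
have lt_col p q (i : 'I_(p - q)) : (i + q < p)%N by have := ltn_ord i; lia.
rewrite -[X in (X * _)%N]card_ord -[X in (_ * X)%N]card_ord -card_prod.
(* As i < m, this weight encodes the lexicographic order on (i + j, i). *)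
apply: (@rank_ge_triangular _ _ _ _ _
  (fun s => mxtens_index (Ordinal (lt_row m b s.1), Ordinal (lt_row n c s.2)))
  (fun s => mxtens_index (Ordinal (lt_col m b s.1), Ordinal (lt_col n c s.2)))
  (fun s => (s.1 + s.2) * m + s.1)%N) => [[i j]|[i j] [i' j'] ts le_w].
  by rewrite kron_eval_sub_entry /= !leq_addr !addKn ifT //; lia.
rewrite kron_eval_sub_entry /=; case: ifP => // /and3P[ii jj ij].
have ltm : (i < m)%N by apply: lt_row.
have ltm' : (i' < m)%N by apply: lt_row.
move: le_w => /= le_w.
have ne : ~ ((i = i' :> nat) /\ (j = j' :> nat)).
  by case=> e1 e2; move/eqP: ts; apply; congr (_, _); apply: val_inj.
(* The exponent pair is at most (d, b) in that order, and differs from it. *)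
have le_deg : (i + j <= i' + j')%N by nia.
have [eq_deg|lt_deg] := eqVneq (i + j)%N (i' + j')%N; last by apply: low0; lia.
have lt_i : (i < i')%N.
  by move: le_w; rewrite eq_deg leq_add2l; lia.
have -> : (j + c - j' = d - (i + b - i'))%N by lia.
apply: minb; lia.
Qed.
End Kronecker.

Theorem proposition3p11 (F : closedFieldType) (charF0 : [pchar F] =i pred0)
    (m n : nat) (m_ge1 : (1 <= m)%N) (n_ge1 : (1 <= n)%N) (la mu : F)
    (K : nat) (a : 'I_K.+1 -> 'I_K.+1 -> F) (d : nat) :
  let p : {poly {poly F}} :=
    \sum_(i < K.+1) \sum_(j < K.+1) (a i j)%:P *: ('X^i * ('X^j)%:P) in
  let P : 'M[F]_(m * n) :=
    \sum_(i < K.+1) \sum_(j < K.+1)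
      a i j *: (jordan_block m la ^+ i *t jordan_block n mu ^+ j) in
  let delta : int := d%:Z - `|n%:Z - m%:Z| in
  let aa : nat := (maxn m n * minn (minn m n) d)%N in
  let bb : int :=
    if delta <= 0 then (d * minn m n)%N%:Z
    else (d * minn m n)%N%:Z - (delta ^+ 2 %/ 4)%Z in
  (forall c : F, p <> c%:P%:P) ->
  is_local_degree p la mu d ->
  ((m + n - 1 <= d)%N ->
     forall k : nat, num_jordan_blocks P k -> k = (m * n)%N)
  /\
  ((d < m + n - 1)%N ->
     forall k : nat, num_jordan_blocks P k -> bb <= k%:Z /\ (k <= aa)%N).
Proof.
move=> p P delta aa bb _ [d_gt0 [b0 [c0 [bcd0 tbc0]]] d_min].
have tE b c : (hasse_deriv b c p).[la%:P].[mu] = taylor_coef la mu a b c.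
  exact: hasse_deriv_eval.
have low0 b c : (0 < b + c < d)%N -> taylor_coef la mu a b c = 0.
  move=> /andP[bc_gt0 bcd]; apply/eqP; apply: contraTT bcd => tbc.
  rewrite -leqNgt; apply: d_min => //; exists b, c.
  by split=> //; rewrite tE; apply/eqP.
have PE : P = kron_eval m n la mu a by [].
set c := taylor_coef la mu a 0 0.
have raise := @kron_eval_sub_raise F m n la mu _ a d low0.
have [e Qe] := raising_nilpotent raise d_gt0.
have blocks k : num_jordan_blocks P k -> k = (m * n - \rank (P - c%:M)%R)%N.
  by rewrite PE; apply: num_jordan_blocks_single_eigenvalue Qe.
split=> [le_d k /blocks-> | lt_d k /blocks->].
  suff -> : P - c%:M = 0 by rewrite mxrank0 subn0.
  apply/matrixP => u v; rewrite [RHS]mxE PE; apply: raise.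
  case: (mxtens_indexP u) => i j; case: (mxtens_indexP v) => i' j'.
  rewrite /box_deg !mxtens_indexK /=.
  by have := ltn_ord i'; have := ltn_ord j'; lia.
split.
  (* The truncated difference d - (max - min) is max(delta, 0), so that the two
     cases of the bound are instances of the same count. *)
  have [k0 le_k0] := antidiagonal_window_sym m_ge1 n_ge1 lt_d.
  have := nullity_ge_window raise k0; rewrite card_box_deg -/P -/c -PE.
  move: (\sum_(i < m) _)%N (m * n - _)%N le_k0 => S k' le_S le_k'.
  have {S le_S le_k'} :
      (d * minn m n <= k' + (d - (maxn m n - minn m n)) ^ 2 %/ 4)%N.
    by rewrite (leq_trans le_S) // leq_add2r.
  rewrite /bb; case: ifPn => [le_delta|].
    have -> : (d - (maxn m n - minn m n) = 0)%N.
      by rewrite /delta in le_delta; lia.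
    by rewrite addn0.
  rewrite -ltNge => delta_gt0.
  have -> : delta = (d - (maxn m n - minn m n))%N.
    by rewrite /delta in delta_gt0 *; lia.
  rewrite expr2 -PoszM mulnn divz_nat.
  by move: (_ %/ 4)%N (d * _)%N => x y; lia.
have [le_d|lt_d'] := leqP (minn m n) d.
  rewrite /aa (minn_idPl le_d) (leq_trans (leq_subr _ _)) //.
  by case: (leqP m n) => _; rewrite // mulnC.
rewrite /aa (minn_idPr (ltnW lt_d')).
have ex_b : exists b, (b <= d)%N && (taylor_coef la mu a b (d - b) != 0).
  exists b0; rewrite -{1}bcd0 leq_addr /= -tE -bcd0 addKn; exact/eqP.
case: (ex_minnP ex_b) => b /andP[le_bd tb] b_min.
have rk : ((m - b) * (n - (d - b)) <= \rank (P - c%:M)%R)%N.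
  apply: rank_kron_eval_sub_ge => // b' lt_b.
  apply/eqP; apply: contraT => tb'.
  by have := b_min b'; rewrite tb' andbT; lia.
have bcd : (b + (d - b))%N = d by rewrite subnKC.
(* For m <= n the difference of the two sides is (d - b)(n - m + b), and for
   n <= m it is b (m - n + d - b). *)
suff : (m * n <= maxn m n * d + (m - b) * (n - (d - b)))%N by lia.
have [x mE] : exists x, m = (b + x)%N by exists (m - b)%N; lia.
have [y nE] : exists y, n = (d - b + y)%N by exists (n - (d - b))%N; lia.
rewrite {}mE {}nE; move: (d - b)%N bcd => z <-.
rewrite !addKn; case: leqP; nia.
Qed.
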